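(* In the AI-augmented cascade model with symmetric prior $\ell_0=0$ and $q,\alpha\in(\tfrac12,1)$, let $\tau=\inf\{j\ge1:|P_j|\ge L_q\}$ be the cascade-formation time. (a) If $\alpha\ge q$, then $\tau=1$. (b) If $\alpha\in(\tfrac12,q)$, then the conditional law of $\tau$ given $(c,\theta)$ depends only on $q$ and on whether $c=\theta$, and not on the value of $\alpha$ within this interval. Moreover $$\Pr(\tau=2\mid c=\theta)=q,\qquad \Pr(\tau=2\mid c\ne\theta)=1-q,$$ $$\mathbb E[\tau\mid c=\theta]=1+\frac{2-q}{1-q+q^2},\qquad \mathbb E[\tau\mid c\neq\theta]=1+\frac{1+q}{1-q+q^2},$$ so that a correct AI prediction yields a strictly shorter expected cascade-formation time, with difference $$\mathbb E[\tau\mid c\ne\theta]-\mathbb E[\tau\mid c=\theta]=\frac{2q-1}{1-q+q^2}>0 .$$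
   Context: AI-augmented cascade model. A binary state $\theta\in\{0,1\}$ has prior $\pi_0=\Pr(\theta=1)$, $\ell_0=\log\frac{\pi_0}{1-\pi_0}$. Users $i=1,2,\dots$ act sequentially. User $i$ has a private signal $s_i\in\{0,1\}$ with $\Pr(s_i=\theta\mid\theta)=q$; there is one common AI signal $c\in\{0,1\}$ with $\Pr(c=\theta\mid\theta)=\alpha$, seen by every user; given $\theta$, the variables $c,s_1,s_2,\dots$ are mutually independent. User $i$ observes $s_i$, $c$ and the public history $(J_1,\dots,J_{i-1})$. Write $L_\rho=\log\frac{\rho}{1-\rho}$ and $\lambda(x;\rho)=(2x-1)L_\rho$ for $x\in\{0,1\}$. The public log-odds are $P_i=\ell_0+\lambda(c;\alpha)+\sum_{j<i}\psi_j(J_j)$, where $\psi_j(J_j)=\log\frac{\Pr(J_j\mid\theta=1,P_j)}{\Pr(J_j\mid\theta=0,P_j)}$ (probabilities conditional on the public log-odds $P_j$ under which user $j$ acted). User $i$'s posterior log-odds are $\ell_i=P_i+\lambda(s_i;q)$, and her judgment is $J_i=1$ if $\ell_i>0$, $J_i=0$ if $\ell_i<0$, and $J_i=\mathbf 1\{P_i\ge0\}$ if $\ell_i=0$. *)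

(* Defs.v *)
From HB Require Import structures.
From mathcomp Require Import all_boot all_order all_algebra.
From mathcomp Require Import all_classical all_reals all_analysis.
From mathcomp Require Import measurable_realfun.

Set Implicit Arguments.
Unset Strict Implicit.
Unset Printing Implicit Defensive.

Import Order.TTheory GRing.Theory Num.Theory.
Import numFieldNormedType.Exports.

Local Open Scope classical_set_scope.
Local Open Scope ring_scope.

(* MathComp-Analysis.  Users are numbered from 0: index k below stands for
   user k + 1, so [public_log_odds M k] is P_(k+1), the public log-odds after k
   judgments. *)

(* With x / 0 = 0, both conditional operators are 0 when P A = 0. *)
Definition cprob d (T : measurableType d) (R : realType) (P : probability T R)
  (B A : set T) : R := fine (P (B `&` A)) / fine (P A).

Definition cexpectation d (T : measurableType d) (R : realType)
  (P : probability T R) (X : T -> \bar R) (A : set T) : \bar R :=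
  ((\int[P]_(w in A) X w) * ((fine (P A))^-1)%:E)%E.

Definition cond_mutual_independence d (T : measurableType d) (R : realType)
  (P : probability T R) (A : set T) (I : eqType) (X : I -> T -> bool) : Prop :=
  forall (F : seq I) (B : I -> set bool), uniq F ->
    cprob P (\bigcap_(i in [set` F]) (X i @^-1` B i)) A =
    \prod_(i <- F) cprob P (X i @^-1` B i) A.

Definition logit (R : realType) (rho : R) : R := ln (rho / (1 - rho)).

Definition llr (R : realType) (x : bool) (rho : R) : R :=
  (2 * x%:R - 1) * logit rho.

(* [None] indexes the AI signal and [Some k] the k-th private signal. *)
Record cascade_model (R : realType) (pi0 q alpha : R) := CascadeModel {
  cm_display : measure_display;
  Omega : measurableType cm_display;
  Pr : probability Omega R;
  theta : {RV Pr >-> bool};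
  ai : {RV Pr >-> bool};
  sig : nat -> {RV Pr >-> bool};
  prior_nondegenerate : 0 < pi0 < 1;
  prior_law : Pr [set w | theta w = true] = pi0%:E;
  ai_accuracy : forall t : bool,
    cprob Pr [set w | ai w = theta w] [set w | theta w = t] = alpha;
  sig_accuracy : forall (k : nat) (t : bool),
    cprob Pr [set w | sig k w = theta w] [set w | theta w = t] = q;
  signals_indep : forall t : bool,
    cond_mutual_independence Pr [set w | theta w = t]
      (fun o : option nat => if o is Some k then sig k : Omega -> bool
                             else ai : Omega -> bool)
}.

Definition judge (R : realType) (p l : R) : bool :=
  if 0 < l then true else if l < 0 then false else 0 <= p.

Definition posterior_log_odds (R : realType) (pi0 q alpha : R)
  (M : cascade_model pi0 q alpha) (p : Omega M -> R) (k : nat) (w : Omega M) : R :=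
  p w + llr (sig M k w) q.

(* The judgment of user k, and the log-likelihood ratio it reveals, when [p] is
   the public log-odds, as a random variable, under which she acts. *)
Definition judgment (R : realType) (pi0 q alpha : R)
  (M : cascade_model pi0 q alpha) (p : Omega M -> R) (k : nat) (w : Omega M) : bool :=
  judge (p w) (posterior_log_odds p k w).

Definition psi (R : realType) (pi0 q alpha : R)
  (M : cascade_model pi0 q alpha) (p : Omega M -> R) (k : nat) (w : Omega M) : R :=
  let lik (t : bool) :=
    cprob (Pr M) [set v | judgment p k v = judgment p k w]
                 [set v | theta M v = t /\ p v = p w] in
  ln (lik true / lik false).

Fixpoint public_log_odds (R : realType) (pi0 q alpha : R)
  (M : cascade_model pi0 q alpha) (k : nat) : Omega M -> R :=
  if k is j.+1 then
    fun w => @public_log_odds R pi0 q alpha M j w +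
             psi (@public_log_odds R pi0 q alpha M j) j w
  else fun w => logit pi0 + llr (ai M w) alpha.

Arguments public_log_odds {R pi0 q alpha} M k w.

Lemma public_log_oddsE (R : realType) (pi0 q alpha : R)
  (M : cascade_model pi0 q alpha) (k : nat) (w : Omega M) :
  public_log_odds M k w = logit pi0 + llr (ai M w) alpha +
    \sum_(j < k) psi (public_log_odds M j) j w.
Proof.
by elim: k => [|k IHk] /=; rewrite ?big_ord0 ?addr0// big_ord_recr/= addrA IHk.
Qed.

(* The infimum of the empty set is +oo. *)
Definition cascade_time (R : realType) (pi0 q alpha : R)
  (M : cascade_model pi0 q alpha) (w : Omega M) : \bar R :=
  ereal_inf [set (k.+1%:R)%:E | k in [set k | logit q <= `|public_log_odds M k w|]].

Arguments cascade_time {R pi0 q alpha} M w.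

(* Main.v *)
(* The public log-odds before user k acts are a function of c, s_1, ..., s_(k-1),
   hence conditionally independent of s_k given theta.  So psi adds
   lambda(s_k; q) as long as |P_k| < L_q, and 0 afterwards.  If
   alpha < q, then P_2 stays in (- L_q, L_q) only if s_1 differs from c, and then
   P_3 does only if s_2 = c, which restores P_3 = P_1.  Thus tau exceeds k + 1
   exactly when s_1 <> c, s_2 = c, s_3 <> c, ... up to s_k; given c and theta
   this has a probability that is a product of alternating factors q and 1 - q,
   and E[tau] = 1 + sum_k Pr(tau > k + 1). *)

Require Import Defs.
From HB Require Import structures.
From mathcomp Require Import all_boot all_order all_algebra.
From mathcomp Require Import all_classical all_reals all_analysis.
From mathcomp Require Import measurable_realfun.
From mathcomp Require Import ring lra.
Import Order.TTheory GRing.Theory Num.Theory.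
Import numFieldNormedType.Exports.
Local Open Scope classical_set_scope.
Local Open Scope ring_scope.

Set Implicit Arguments.
Unset Strict Implicit.
Unset Printing Implicit Defensive.

(** * Events determined by finitely many binary signals *)

(** A pointwise substitute for membership in the sigma-algebra generated by the [X i], [i \in F].
    One implication suffices, the condition being symmetric in [w] and [w']. *)
Definition determined_by (T : Type) (I : eqType) (X : I -> T -> bool)
    (F : seq I) (E : set T) :=
  forall w w', (forall i, i \in F -> X i w = X i w') -> E w -> E w'.

(** Indexing by [seq_sub F] makes the codomain finite; the nonempty fibers are the atoms of the
    algebra generated by the signals in [F]. *)
Definition profile (T : Type) (I : choiceType) (X : I -> T -> bool) (F : seq I)
    (w : T) : {ffun seq_sub F -> bool} :=
  [ffun i => X (ssval i) w].

Lemma profileP (T : Type) (I : choiceType) (X : I -> T -> bool) (F : seq I)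
    (w w' : T) :
  profile X F w = profile X F w' <->
  (forall i, i \in F -> X i w = X i w').
Proof.
split=> [/ffunP eqp i iF|eqX]; first by have := eqp (SeqSub iF); rewrite !ffunE.
by apply/ffunP => i; rewrite !ffunE; apply: eqX; apply: ssvalP.
Qed.

Lemma profile_fiber (T : Type) (I : choiceType) (X : I -> T -> bool)
    (F : seq I) (w : T) :
  profile X F @^-1` [set profile X F w] =
  \bigcap_(i in [set` F]) (X i @^-1` [set X i w]).
Proof. by apply/seteqP; split => w' /=; rewrite profileP. Qed.

Lemma determined_bigcup (T : Type) (I : choiceType) (X : I -> T -> bool)
    (F : seq I) (E : set T) :
  determined_by X F E ->
  E = \bigcup_(h in profile X F @` E) (profile X F @^-1` [set h]).
Proof.
move=> detE; apply/seteqP; split => [w Ew|w [h [w' Ew' <-]]].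
  by exists (profile X F w) => //; exists w.
by move=> /= /profileP eqX; apply: (detE w') => // i iF; rewrite eqX.
Qed.

Lemma measurable_profile_fiber (d : measure_display) (T : measurableType d)
    (I : choiceType) (X : I -> T -> bool) (F : seq I) (h : {ffun seq_sub F -> bool}) :
  (forall i b, measurable (X i @^-1` [set b])) ->
  measurable (profile X F @^-1` [set h]).
Proof.
(* The intersection formula for a fiber needs a point of it; a profile that is never attained has an
   empty fiber. *)
move=> mX; have [[w <-]|nh] := pselect (exists w, profile X F w = h).
  by rewrite profile_fiber; apply: fin_bigcap_measurable => // i _.
rewrite (_ : _ @^-1` _ = set0); first exact: measurable0.
by apply/seteqP; split => // w hw; apply: nh; exists w.
Qed.

Lemma measurable_determined (d : measure_display) (T : measurableType d)
    (I : choiceType) (X : I -> T -> bool) (F : seq I) (E : set T) :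
  (forall i b, measurable (X i @^-1` [set b])) ->
  determined_by X F E -> measurable E.
Proof.
move=> mX /determined_bigcup ->; apply: fin_bigcup_measurable => // h _.
exact: measurable_profile_fiber.
Qed.

(** Conditional independence speaks of cylinders only. An event determined by [F] is a finite
    disjoint union of cylinders over [F]; on each of them the product formulas for [i :: F] and for
    [F] differ by exactly the factor of [i], and additivity does the rest. *)
Lemma cond_independence_determined (d : measure_display) (T : measurableType d)
    (R : realType) (P : probability T R) (I : choiceType) (X : I -> T -> bool)
    (A E : set T) (F : seq I) (i : I) (b : bool) :
  (forall i b, measurable (X i @^-1` [set b])) -> measurable A -> P A != 0%E ->
  cond_mutual_independence P A X ->
  uniq (i :: F) -> determined_by X F E ->
  P (E `&` X i @^-1` [set b] `&` A) =
  ((cprob P (X i @^-1` [set b]) A)%:E * P (E `&` A))%E.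
Proof.
move=> mX mA PA0 indX uiF detE; have /andP[iF uF] := uiF.
have finP (B : set T) : measurable B -> P B \is a fin_num.
  exact: fin_num_measure.
have PA_neq0 : fine (P A) != 0.
  by rewrite fine_eq0 ?finP.
have cylE (w : T) :
    P (profile X F @^-1` [set profile X F w]
       `&` (X i @^-1` [set b] `&` A)) =
    ((cprob P (X i @^-1` [set b]) A)%:E *
     P (profile X F @^-1` [set profile X F w] `&` A))%E.
  rewrite profile_fiber.
  (* As [i] is not in [F], this single family describes both the cylinder over [F] and its
     refinement by the value [b] at [i]. *)
  pose B j := if j == i then [set b] else [set X j w].
  have BF j : j \in F -> B j = [set X j w].
    by move=> jF; rewrite /B; case: eqP => // ji; rewrite -ji jF in iF.
  have capF : \bigcap_(j in [set` F]) (X j @^-1` B j) =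
              \bigcap_(j in [set` F]) (X j @^-1` [set X j w]).
    by apply: eq_bigcapr => j /= jF; rewrite BF.
  have capiF : \bigcap_(j in [set` i :: F]) (X j @^-1` B j) =
               (X i @^-1` [set b]) `&`
               \bigcap_(j in [set` F]) (X j @^-1` [set X j w]).
    have -> : [set` i :: F] = i |` [set` F].
      apply/seteqP; split => j /=; rewrite inE; first by case/orP => [/eqP|]; [left|right].
      by case=> [->|->]; rewrite ?eqxx ?orbT.
    by rewrite bigcap_setU1 capF /B eqxx.
  have := indX _ B uiF.
  rewrite big_cons -(indX F B uF) capF capiF /B eqxx /cprob => eqc.
  have mF : measurable (\bigcap_(j in [set` F]) (X j @^-1` [set X j w])).
    by apply: fin_bigcap_measurable => // j _.
  rewrite setIA [_ `&` X i @^-1` _]setIC -[LHS]fineK; last first.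
    by apply: finP; do 2?apply: measurableI.
  rewrite -[X in (_ * X)%E]fineK; last by apply: finP; apply: measurableI.
  rewrite -EFinM; congr EFin.
  apply: (mulIf (invr_neq0 PA_neq0)); rewrite eqc /cprob; ring.
have mfib (h : {ffun seq_sub F -> bool}) (B : set T) : measurable B ->
    measurable (profile X F @^-1` [set h] `&` B).
  by move=> mB; apply: measurableI => //; apply: measurable_profile_fiber.
have trivfib (D : set {ffun seq_sub F -> bool}) (B : set T) :
    trivIset D (fun h => profile X F @^-1` [set h] `&` B).
  by move=> h h' _ _ [w [[/= <- _] [<- _]]].
have mXA : measurable (X i @^-1` [set b] `&` A) by apply: measurableI.
rewrite -setIA (determined_bigcup detE) !setI_bigcupl.
have finD : finite_set (profile X F @` E) by exact: finite_finset.
rewrite !measure_fin_bigcup//; try by move=> h _; apply: mfib.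
rewrite ge0_mule_fsumr; last by move=> h; apply: measure_ge0.
by apply: eq_fsbigr => h /set_mem[w _ <-]; apply: cylE.
Qed.

(** * Log-odds and the judgment rule *)

(** The conditional probability that a signal of accuracy [rho] takes the value [b] in state [t]. *)
Definition agreement (R : realType) (rho : R) (b t : bool) : R :=
  if b == t then rho else 1 - rho.

Lemma agreement_itv (R : realType) (rho : R) (b t : bool) :
  0 < rho < 1 -> 0 < agreement rho b t < 1.
Proof. by rewrite /agreement; case: (b == t) => //; lra. Qed.

Lemma logit_gt0 (R : realType) (rho : R) : 2^-1 < rho < 1 -> 0 < logit rho.
Proof.
move=> rho_itv; apply: ln_gt0; rewrite ltr_pdivlMr; lra.
Qed.

Lemma logit_ltr (R : realType) (a b : R) :
  0 < a < 1 -> 0 < b < 1 -> a < b -> logit a < logit b.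
Proof.
move=> a01 b01 ab; rewrite ltr_ln ?posrE ?divr_gt0//; try lra.
rewrite ltr_pdivrMr; last lra.
rewrite mulrAC ltr_pdivlMr; last lra.
by rewrite !mulrBr; lra.
Qed.

Lemma logit_ler (R : realType) (a b : R) :
  0 < a < 1 -> 0 < b < 1 -> a <= b -> logit a <= logit b.
Proof.
move=> a01 b01; rewrite le_eqVlt => /predU1P[->//|ab].
by apply/ltW/logit_ltr.
Qed.

Lemma llrE (R : realType) (x : bool) (rho : R) :
  llr x rho = if x then logit rho else - logit rho.
Proof. by rewrite /llr; case: x; rewrite /=; ring. Qed.

(** The private term outweighs the public one, so the posterior log-odds have the sign of the
    signal. *)
Lemma judge_informative (R : realType) (p q : R) (s : bool) :
  `|p| < logit q -> judge p (p + llr s q) = s.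
Proof.
rewrite ltr_norml llrE /judge => /andP[p1 p2]; case: s.
  by rewrite ifT//; lra.
by rewrite ifF ?ifT//; lra.
Qed.

(** The signal can at most cancel the public log-odds. It does so only when their absolute value is
    exactly [logit q], and then the tie-breaking rule also follows the sign of [p]. *)
Lemma judge_cascade (R : realType) (p q : R) (s : bool) :
  0 < logit q -> logit q <= `|p| -> judge p (p + llr s q) = (0 <= p).
Proof.
move=> Lq; rewrite ler_normr llrE /judge => pL.
by case: s; case: ltrP => l0; (try case: ltrP => l1) => //; apply/esym;
  rewrite ?(leNgt 0 p); (try apply/negbTE); rewrite ?negbK; case/orP: pL; lra.
Qed.

(** * The signals on which the public history depends *)

Definition observation (R : realType) (pi0 q alpha : R)
    (M : cascade_model pi0 q alpha) (o : option nat) : Omega M -> bool :=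
  if o is Some k then sig M k : Omega M -> bool else ai M : Omega M -> bool.
Arguments observation {R pi0 q alpha} M o _.

(** The AI signal and the private signals of index below [k]; the signal of user [k] herself is
    excluded. *)
Definition past (k : nat) : seq (option nat) := None :: [seq Some j | j <- iota 0 k].

Lemma mem_past (k : nat) (o : option nat) :
  (o \in past k) = if o is Some j then (j < k)%N else true.
Proof.
rewrite inE; case: o => [j|]//=; rewrite mem_map; last by move=> ? ? [].
by rewrite mem_iota.
Qed.

Lemma past_uniq (k : nat) : uniq (past k).
Proof.
rewrite /= map_inj_uniq ?iota_uniq ?andbT; last by move=> ? ? [].
by apply/mapP => -[].
Qed.

Definition agree_upto (R : realType) (pi0 q alpha : R)
    (M : cascade_model pi0 q alpha) (k : nat) (v w : Omega M) :=
  forall o, o \in past k -> observation M o v = observation M o w.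

Lemma agree_uptoS (R : realType) (pi0 q alpha : R)
    (M : cascade_model pi0 q alpha) (k : nat) (v w : Omega M) :
  agree_upto k.+1 v w <-> agree_upto k v w /\ sig M k v = sig M k w.
Proof.
split=> [vw|[vw vwk] o]; first split.
- move=> o; rewrite mem_past => ok; apply: vw; rewrite mem_past.
  by case: o ok => // j /ltnW.
- by apply: (vw (Some k)); rewrite mem_past.
- rewrite mem_past; case: o => [j|_]; last by apply: vw; rewrite mem_past.
  rewrite ltnS leq_eqVlt => /predU1P[->//|jk].
  by apply: vw; rewrite mem_past.
Qed.

Lemma agree_upto_ai (R : realType) (pi0 q alpha : R)
    (M : cascade_model pi0 q alpha) (k : nat) (v w : Omega M) :
  agree_upto k v w -> ai M v = ai M w.
Proof. by move=> /(_ None); rewrite mem_past; apply. Qed.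

Lemma agree_upto_sig (R : realType) (pi0 q alpha : R)
    (M : cascade_model pi0 q alpha) (k j : nat) (v w : Omega M) :
  (j < k)%N -> agree_upto k v w -> sig M j v = sig M j w.
Proof. by move=> jk /(_ (Some j)); rewrite mem_past; apply. Qed.

(** * Signal probabilities given the state *)

Lemma measurable_rv_eq (d : measure_display) (T : measurableType d)
    (R : realType) (P : probability T R) (X : {RV P >-> bool}) (b : bool) :
  measurable [set w | X w = b].
Proof. by rewrite -[[set _ | _]]/(X @^-1` [set b]); exact: measurable_funPTI. Qed.

Lemma measurable_observation (R : realType) (pi0 q alpha : R)
    (M : cascade_model pi0 q alpha) (o : option nat) (b : bool) :
  measurable (observation M o @^-1` [set b]).
Proof. by case: o => [k|]; apply: measurable_rv_eq. Qed.

Lemma prob_theta (R : realType) (pi0 q alpha : R)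
    (M : cascade_model pi0 q alpha) (t : bool) :
  Pr M [set w | theta M w = t] = (if t then pi0 else 1 - pi0)%:E.
Proof.
case: t; first exact: prior_law.
have -> : [set w | theta M w = false] = ~` [set w | theta M w = true].
  by apply/seteqP; split => w /=; case: (theta M w).
rewrite probability_setC ?prior_law//; exact: measurable_rv_eq.
Qed.

Lemma prob_theta_gt0 (R : realType) (pi0 q alpha : R)
    (M : cascade_model pi0 q alpha) (t : bool) :
  (0 < Pr M [set w | theta M w = t])%E.
Proof.
rewrite prob_theta lte_fin; have := prior_nondegenerate M.
by case: t; lra.
Qed.

(** On [Y = t], the event [X = Y] is [X = t], which settles [b = t]; the other value of [b] is the
    complement within [Y = t]. *)
Lemma cprob_agreement (d : measure_display) (T : measurableType d)
    (R : realType) (P : probability T R) (X Y : {RV P >-> bool}) (rho : R)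
    (b t : bool) :
  P [set w | Y w = t] != 0%E ->
  cprob P [set w | X w = Y w] [set w | Y w = t] = rho ->
  cprob P [set w | X w = b] [set w | Y w = t] = agreement rho b t.
Proof.
move=> PY0; set A := [set w | Y w = t] in PY0 *.
have mA : measurable A by exact: measurable_rv_eq.
have finP (B : set T) : measurable B -> P B \is a fin_num.
  exact: fin_num_measure.
have PA_neq0 : fine (P A) != 0 by rewrite fine_eq0 ?finP.
have -> : cprob P [set w | X w = Y w] A = cprob P [set w | X w = t] A.
  rewrite /cprob; congr (fine (P _) / _).
  by apply/seteqP; split => w [/= XY Yt]; split => //=; rewrite ?Yt in XY *.
have mXA c : measurable ([set w | X w = c] `&` A).
  by apply: measurableI => //; apply: measurable_rv_eq.
rewrite /agreement => <-; case: eqP => [->//|bt]; rewrite /cprob.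
have -> : [set w | X w = b] `&` A = A `\` ([set w | X w = t] `&` A).
  apply/seteqP; split => w [].
    by move=> /= Xb Aw; split => // -[]; rewrite /= Xb.
  move=> Aw XtA; split => //=; have : X w <> t by move=> Xt; apply: XtA.
  have neq_eq (a b' c : bool) : b' <> c -> a <> c -> a = b'.
    by move: a b' c => [] [] [].
  exact: neq_eq bt.
rewrite measureD//; last by rewrite ltey_eq finP.
rewrite setIidr; last exact: subIsetr.
by rewrite fineB ?finP// mulrBl divff.
Qed.

Lemma cprob_observation (R : realType) (pi0 q alpha : R)
    (M : cascade_model pi0 q alpha) (o : option nat) (b t : bool) :
  cprob (Pr M) (observation M o @^-1` [set b]) [set w | theta M w = t] =
  agreement (if o is Some _ then q else alpha) b t.
Proof.
have Pt := prob_theta_gt0 M t.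
case: o => [k|]; apply: cprob_agreement; rewrite ?gt_eqF//.
- exact: sig_accuracy.
- exact: ai_accuracy.
Qed.

Lemma prob_ai_theta (R : realType) (pi0 q alpha : R)
    (M : cascade_model pi0 q alpha) (x t : bool) :
  Pr M [set w | ai M w = x /\ theta M w = t] =
  (agreement alpha x t * if t then pi0 else 1 - pi0)%:E.
Proof.
have Pt := prob_theta_gt0 M t.
have := cprob_observation M None x t; rewrite /cprob prob_theta /= => <-.
rewrite divfK; last by move: Pt; rewrite prob_theta lte_fin => /gt_eqF ->.
rewrite fineK//; apply: fin_num_measure.
by apply: measurableI; apply: measurable_rv_eq.
Qed.

(** Conditional independence of the signals is applied here: the index [Some k] lies outside
    [past k]. The product form avoids dividing by the probability of [E]. *)
Lemma prob_next_signal (R : realType) (pi0 q alpha : R)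
    (M : cascade_model pi0 q alpha) (k : nat) (E : set (Omega M)) (b t : bool) :
  determined_by (observation M) (past k) E ->
  Pr M (E `&` [set w | sig M k w = b] `&` [set w | theta M w = t]) =
  ((agreement q b t)%:E * Pr M (E `&` [set w | theta M w = t]))%E.
Proof.
move=> detE; rewrite -(cprob_observation M (Some k)).
apply: (@cond_independence_determined _ _ _ _ _ _ _ _ (past k) (Some k)) => //.
- exact: measurable_observation.
- exact: measurable_rv_eq.
- by rewrite gt_eqF ?prob_theta_gt0.
- exact: signals_indep.
- by rewrite cons_uniq past_uniq mem_past ltnn.
Qed.

(** Each further signal multiplies the probability by [q] or [1 - q], both positive. This keeps the
    conditioning events in [psi] from being null. *)
Lemma prob_agree_upto_gt0 (R : realType) (pi0 q alpha : R)
    (M : cascade_model pi0 q alpha) (k : nat) (w : Omega M) (t : bool) :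
  0 < q < 1 -> 0 < alpha < 1 ->
  (0 < Pr M ([set v | agree_upto k v w] `&` [set v | theta M v = t]))%E.
Proof.
move=> q01 a01; elim: k => [|k IHk].
  have -> : [set v | agree_upto 0 v w] `&` [set v | theta M v = t] =
            [set v | ai M v = ai M w /\ theta M v = t].
    apply/seteqP; split => v [/= vw thv]; split => //=.
      exact: (agree_upto_ai vw).
    by move=> [j|_]; rewrite ?mem_past.
  have /andP[g0 _] := agreement_itv (ai M w) t a01.
  rewrite prob_ai_theta lte_fin mulr_gt0//.
  by have := prob_theta_gt0 M t; rewrite prob_theta lte_fin.
have -> : [set v | agree_upto k.+1 v w] =
          [set v | agree_upto k v w] `&` [set v | sig M k v = sig M k w].
  by apply/seteqP; split => v /= /agree_uptoS.
rewrite prob_next_signal; last first.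
  by move=> v v' vv' vw o ok /=; rewrite -vv' ?vw.
by rewrite mule_gt0// lte_fin; case/andP: (agreement_itv (sig M k w) t q01).
Qed.

(** * Increments of the public log-odds *)

Definition past_measurable (R : realType) (pi0 q alpha : R)
    (M : cascade_model pi0 q alpha) (U : Type) (k : nat) (p : Omega M -> U) :=
  forall v w, agree_upto k v w -> p v = p w.

(* The event of the past has positive probability, so no likelihood is the junk
   value 0 / 0. *)
Lemma psiE (R : realType) (pi0 q alpha : R) (M : cascade_model pi0 q alpha)
    (k : nat) (p : Omega M -> R) (w : Omega M) :
  2^-1 < q < 1 -> 0 < alpha < 1 -> past_measurable k p ->
  psi p k w = if `|p w| < logit q then llr (sig M k w) q else 0.
Proof.
move=> q_itv a01 pP.
have q01 : 0 < q < 1 by lra.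
pose A t := [set v | theta M v = t /\ p v = p w].
pose E := [set v | p v = p w].
have AE t : A t = E `&` [set v | theta M v = t] by rewrite /A setIC.
have detE : determined_by (observation M) (past k) E.
  by move=> v v' vv'; rewrite /E /= => <-; apply/esym/pP => o ok; rewrite vv'.
have mE : measurable E.
  exact: measurable_determined (@measurable_observation _ _ _ _ M) detE.
have mA t : measurable (A t).
  by rewrite AE; apply: measurableI => //; apply: measurable_rv_eq.
have finPA t : Pr M (A t) \is a fin_num by exact: fin_num_measure.
have PA0 t : fine (Pr M (A t)) != 0.
  rewrite fine_eq0// gt_eqF//.
  apply: lt_le_trans (prob_agree_upto_gt0 k w t q01 a01) _.
  rewrite AE; apply: le_measure; rewrite ?inE.
  - apply: measurableI; last exact: measurable_rv_eq.
    apply: (measurable_determined (F := past k) (@measurable_observation _ _ _ _ M)).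
    by move=> v v' vv' vw o ok /=; rewrite -vv' ?vw.
  - by apply: measurableI => //; apply: measurable_rv_eq.
  - by apply: setSI => v /pP.
rewrite /psi -/(A true) -/(A false); case: ifPn => [pL|pL].
  (* Below the threshold the judgment equals the signal, which is independent of the past given the
     state, so conditioning on the value of [p] leaves the likelihood unchanged. *)
  have likE t : cprob (Pr M) [set v | judgment p k v = judgment p k w] (A t) =
                agreement q (sig M k w) t.
    rewrite /cprob.
    have -> : [set v | judgment p k v = judgment p k w] `&` A t =
              E `&` [set v | sig M k v = sig M k w] `&` [set v | theta M v = t].
      apply/seteqP; split => v /=; rewrite /A /E /judgment /posterior_log_odds /=.
        by case=> + [-> pvw]; rewrite pvw !judge_informative.
      by case=> -[pvw svw] ->; rewrite pvw !judge_informative.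
    rewrite prob_next_signal// -AE -[X in fine X]/(_ * _)%E fineM// mulfK//.
  rewrite !likE llrE /agreement; case: (sig M k w) => //=.
  by rewrite -lnV ?invf_div// posrE divr_gt0//; lra.
(* In a cascade the judgment is a function of [p] alone: both likelihoods are 1 and the increment is
   [ln 1]. *)
have likE t : cprob (Pr M) [set v | judgment p k v = judgment p k w] (A t) = 1.
  rewrite /cprob setIidr ?divff// => v [_ pvw].
  rewrite /= /judgment /posterior_log_odds pvw.
  by rewrite !judge_cascade ?logit_gt0// leNgt.
by rewrite !likE divr1 ln1.
Qed.

(** By induction: the hypothesis at [k] is what [psiE] requires, and the increment it yields depends
    only on the public log-odds at [k] and on signal [k]. *)
Lemma public_log_odds_past (R : realType) (pi0 q alpha : R)
    (M : cascade_model pi0 q alpha) (k : nat) :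
  2^-1 < q < 1 -> 0 < alpha < 1 -> past_measurable k (public_log_odds M k).
Proof.
move=> q_itv a01; elim: k => [|k IHk] v w vw /=.
  by rewrite (agree_upto_ai vw).
rewrite !psiE//; move/agree_uptoS : vw => [vw ->].
by rewrite (IHk _ _ vw).
Qed.

Lemma public_log_oddsS (R : realType) (pi0 q alpha : R)
    (M : cascade_model pi0 q alpha) (k : nat) (w : Omega M) :
  2^-1 < q < 1 -> 0 < alpha < 1 ->
  public_log_odds M k.+1 w = public_log_odds M k w +
    (if `|public_log_odds M k w| < logit q then llr (sig M k w) q else 0).
Proof. by move=> q_itv a01 /=; rewrite psiE//; apply: public_log_odds_past. Qed.

(** * The undecided phase and the public log-odds along it *)

(* Signal k + 1 ends the undecided phase: it agrees with the AI signal after an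
   even number of judgments, and disagrees with it after an odd number. *)
Definition breaking (R : realType) (pi0 q alpha : R)
    (M : cascade_model pi0 q alpha) (k : nat) (w : Omega M) : bool :=
  (sig M k w == ai M w) (+) odd k.

Definition undecided (R : realType) (pi0 q alpha : R)
    (M : cascade_model pi0 q alpha) (k : nat) : set (Omega M) :=
  [set w | forall j, (j < k)%N -> ~~ breaking j w].
Arguments undecided {R pi0 q alpha} M k.

Lemma undecided_le (R : realType) (pi0 q alpha : R)
    (M : cascade_model pi0 q alpha) (j k : nat) :
  (j <= k)%N -> undecided M k `<=` undecided M j.
Proof. by move=> jk w wk i ij; apply/wk/(leq_trans ij). Qed.

Lemma undecidedS (R : realType) (pi0 q alpha : R)
    (M : cascade_model pi0 q alpha) (k : nat) (w : Omega M) :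
  undecided M k.+1 w <-> undecided M k w /\ ~~ breaking k w.
Proof.
split=> [wk|[wk bk] j]; first by split=> [j jk|]; apply: wk => //; apply: ltnW.
by rewrite ltnS leq_eqVlt => /predU1P[->//|]; apply: wk.
Qed.

Lemma undecided_or_breaking (R : realType) (pi0 q alpha : R)
    (M : cascade_model pi0 q alpha) (w : Omega M) :
  (forall k, undecided M k w) \/ exists k, undecided M k w /\ breaking k w.
Proof.
have [[k bk]|nb] := pselect (exists k, breaking k w).
  right; have exb : exists k, breaking k w by exists k.
  exists (ex_minn exb); case: ex_minnP => m bm minm; split=> // j.
  by apply: contraTN => /minm; rewrite -leqNgt.
by left=> k j _; apply/negP => bj; apply: nb; exists j.
Qed.

Lemma undecided_determined (R : realType) (pi0 q alpha : R)
    (M : cascade_model pi0 q alpha) (k : nat) :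
  determined_by (observation M) (past k) (undecided M k).
Proof.
move=> v w vw vk j jk; rewrite /breaking.
by rewrite -(agree_upto_ai vw) -(agree_upto_sig jk vw); apply: vk.
Qed.

Lemma measurable_undecided (R : realType) (pi0 q alpha : R)
    (M : cascade_model pi0 q alpha) (k : nat) : measurable (undecided M k).
Proof.
exact: measurable_determined (@measurable_observation _ _ _ _ M)
  (@undecided_determined _ _ _ _ M k).
Qed.

(* While opposite signals alternate, each one cancels the previous one, so the
   public log-odds only visit two values. *)
Lemma public_log_odds_undecided (R : realType) (pi0 q alpha : R)
    (M : cascade_model pi0 q alpha) (k : nat) (w : Omega M) :
  logit pi0 = 0 -> 2^-1 < alpha < q -> q < 1 -> undecided M k w ->
  public_log_odds M k w =
    llr (ai M w) alpha - (if odd k then llr (ai M w) q else 0) /\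
  `|public_log_odds M k w| < logit q.
Proof.
move=> pi00 aq q1.
have La : 0 < logit alpha by apply: logit_gt0; lra.
have Laq : logit alpha < logit q by apply: logit_ltr; lra.
have ltL c : `|llr (ai M w) alpha - (if c then llr (ai M w) q else 0)| < logit q.
  by rewrite ltr_norml !llrE; case: (ai M w); case: c; apply/andP; split; lra.
move=> wk; suff eqP : public_log_odds M k w =
    llr (ai M w) alpha - (if odd k then llr (ai M w) q else 0).
  by rewrite eqP.
elim: k wk => [_|k IHk /undecidedS[/IHk eqP]].
  by rewrite /= pi00 add0r subr0.
rewrite /breaking public_log_oddsS ?eqP ?ltL; try lra.
rewrite oddS !llrE.
by case: (odd k); case: (ai M w); case: (sig M k w) => //= _; ring.
Qed.

(** For even [k] the absolute value grows from [logit alpha] to [logit alpha + logit q]. For odd [k]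
    it grows from [logit q - logit alpha] to [2 * logit q - logit alpha], which exceeds [logit q] as
    [alpha < q]. *)
Lemma public_log_odds_breaking (R : realType) (pi0 q alpha : R)
    (M : cascade_model pi0 q alpha) (k : nat) (w : Omega M) :
  logit pi0 = 0 -> 2^-1 < alpha < q -> q < 1 -> undecided M k w ->
  breaking k w -> logit q <= `|public_log_odds M k.+1 w|.
Proof.
move=> pi00 aq q1 wk; have [eqP ltP] := public_log_odds_undecided pi00 aq q1 wk.
have La : 0 < logit alpha by apply: logit_gt0; lra.
have Laq : logit alpha < logit q by apply: logit_ltr; lra.
rewrite /breaking public_log_oddsS ?ltP ?eqP; try lra.
rewrite ler_normr !llrE.
by case: (odd k); case: (ai M w); case: (sig M k w) => //= _; apply/orP;
  (try by left; lra); right; lra.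
Qed.

(** * The cascade time, outcome by outcome *)

(** Signal index [k] first shows its effect in the public log-odds of index [k.+1], which belong to
    user [k + 2]; all earlier indices are below the threshold. *)
Lemma cascade_time_breaking (R : realType) (pi0 q alpha : R)
    (M : cascade_model pi0 q alpha) (k : nat) (w : Omega M) :
  logit pi0 = 0 -> 2^-1 < alpha < q -> q < 1 -> undecided M k w ->
  breaking k w -> cascade_time M w = (k.+2%:R)%:E.
Proof.
move=> pi00 aq q1 wk bk; apply/eqP; rewrite eq_le; apply/andP; split.
  by apply: ereal_inf_lbound; exists k.+1 => //=; apply: public_log_odds_breaking.
apply: le_ereal_inf_tmp => _ [j /= Pj <-]; rewrite lee_fin ler_nat ltnS.
rewrite ltnNge; apply/negP => jk.
have [_] := public_log_odds_undecided pi00 aq q1 (undecided_le jk wk).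
by rewrite ltNge Pj.
Qed.

Lemma cascade_time_undecided (R : realType) (pi0 q alpha : R)
    (M : cascade_model pi0 q alpha) (w : Omega M) :
  logit pi0 = 0 -> 2^-1 < alpha < q -> q < 1 -> (forall k, undecided M k w) ->
  cascade_time M w = +oo%E.
Proof.
move=> pi00 aq q1 wk; apply/ereal_inf_pinfty => y [j /= Pj _].
have [_] := public_log_odds_undecided pi00 aq q1 (wk j).
by rewrite ltNge Pj.
Qed.

(** The tail-sum form of the time: if index [n] is the first to break, exactly the terms [k <= n]
    equal 1, for a total of [n + 2]; if none breaks, both sides are infinite. *)
Lemma cascade_time_series (R : realType) (pi0 q alpha : R)
    (M : cascade_model pi0 q alpha) (w : Omega M) :
  logit pi0 = 0 -> 2^-1 < alpha < q -> q < 1 ->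
  cascade_time M w = (1 + \sum_(0 <= k <oo) (\1_(undecided M k) w)%:E)%E.
Proof.
move=> pi00 aq q1.
have ind0 k : (0 <= (\1_(undecided M k) w)%:E :> \bar R)%E by rewrite lee_fin.
have ind1 k : undecided M k w -> (\1_(undecided M k) w)%:E = 1%E :> \bar R.
  by move=> wk; rewrite indicE mem_set.
have [wk|[n [wn bn]]] := undecided_or_breaking w.
  rewrite cascade_time_undecided//.
  rewrite (_ : (\sum_(0 <= k <oo) _)%E = +oo%E)//.
  apply/eqyP => r r0.
  apply: le_trans (nneseries_lim_ge (Num.truncn r).+1 (fun k _ _ => ind0 k)).
  rewrite (eq_bigr (fun=> 1%E)) => [|k _]; last exact: ind1.
  rewrite sumEFin lee_fin sumr_const_nat subn0.
  by apply/ltW; rewrite truncnS_gt.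
rewrite (cascade_time_breaking _ _ _ wn bn)//.
rewrite (nneseries_split 0 n.+1)//= add0n eseries0 ?adde0; last first.
  move=> k nk _; rewrite indicE memNset// => wk.
  by have /undecidedS[_] := undecided_le nk wk; rewrite bn.
rewrite (eq_big_nat _ _ (F2 := fun=> 1%E)) => [|k /andP[_ kn]]; last first.
  by apply: ind1; apply: undecided_le wn.
by rewrite sumEFin sumr_const_nat subn0 -EFinD -(natrD _ 1).
Qed.

(** * Survival probabilities and their sum *)

(** The probability that the first [k] signals do not break, where [m] says whether the AI is
    correct. By symmetry the state is taken to be [true], so that [m] is also the AI signal; factor
    [j] is the probability of differing from it for even [j] and of matching it for odd [j]. *)
Definition survival (R : realType) (q : R) (m : bool) (k : nat) : R :=
  \prod_(j < k) agreement q (m (+) ~~ odd j) true.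

Lemma survivalS (R : realType) (q : R) (m : bool) (k : nat) :
  survival q m k.+1 = survival q m k * agreement q (m (+) ~~ odd k) true.
Proof. by rewrite /survival big_ord_recr. Qed.

Lemma survival_ge0 (R : realType) (q : R) (m : bool) (k : nat) :
  0 < q < 1 -> 0 <= survival q m k.
Proof.
move=> q01; apply: prodr_ge0 => j _.
by have /andP[/ltW] := agreement_itv (m (+) ~~ odd j) true q01.
Qed.

Lemma survival_le (R : realType) (q : R) (m : bool) (k : nat) :
  2^-1 < q < 1 -> survival q m k <= q ^+ k.
Proof.
move=> q_itv; elim: k => [|k IHk]; first by rewrite /survival big_ord0.
rewrite survivalS exprSr ler_pM ?survival_ge0//; try lra.
  by rewrite /agreement; case: (_ == _); lra.
by rewrite /agreement; case: (_ == _); lra.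
Qed.

Lemma survival_cvg0 (R : realType) (q : R) (m : bool) :
  2^-1 < q < 1 -> survival q m k @[k --> \oo] --> 0.
Proof.
move=> q_itv; apply: (@squeeze_cvgr _ _ _ _ (cst 0) (GRing.exp q)).
- by apply: nearW => k; rewrite survival_ge0 ?survival_le//; lra.
- exact: cvg_cst.
- by apply: cvg_expr; rewrite ger0_norm; lra.
Qed.

(* The unique solution of the two equations mean_delay_step. *)
Definition mean_delay (R : realType) (q : R) (m : bool) : R :=
  (if m then 2 - q else 1 + q) / (1 - q + q ^+ 2).

Lemma mean_delay_den_gt0 (R : realType) (q : R) : q < 1 -> 0 < 1 - q + q ^+ 2.
Proof. by move=> q1; have := sqr_ge0 q; lra. Qed.

(** First-step analysis: past a non-breaking signal, the alternation resumes as if the AI signal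
    were reversed. *)
Lemma mean_delay_step (R : realType) (q : R) (m : bool) : q < 1 ->
  mean_delay q m = 1 + agreement q (~~ m) true * mean_delay q (~~ m).
Proof.
move=> /mean_delay_den_gt0 /gt_eqF/negbT den0.
by rewrite /mean_delay /agreement; case: m => /=; field.
Qed.

(** Unrolling [mean_delay_step] [n] times; the role of the AI signal is flipped at each step, whence
    the parity of [n] in the remainder. *)
Lemma sum_survival (R : realType) (q : R) (m : bool) (n : nat) : q < 1 ->
  \sum_(0 <= k < n) survival q m k =
  mean_delay q m - survival q m n * mean_delay q (m (+) odd n).
Proof.
move=> q1; elim: n => [|n IHn].
  by rewrite big_nil /survival big_ord0 addbF mul1r subrr.
rewrite big_nat_recr//= IHn survivalS (mean_delay_step (_ (+) _))//.
by rewrite -addbN; ring.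
Qed.

Lemma survival_series (R : realType) (q : R) (m : bool) : 2^-1 < q < 1 ->
  (\sum_(0 <= k <oo) (survival q m k)%:E)%E = (mean_delay q m)%:E.
Proof.
move=> q_itv; apply/cvg_lim => //.
apply: cvg_EFin; first by apply: nearW => n; rewrite sumEFin.
rewrite (_ : _ \o _ = fun n => mean_delay q m -
    survival q m n * mean_delay q (m (+) odd n)); last first.
  by apply/funext => n /=; rewrite sumEFin/= sum_survival//; lra.
rewrite -[X in _ --> X]subr0; apply: cvgB; first exact: cvg_cst.
(* The coefficient of the remainder alternates between two nonnegative values, so their sum bounds
   it. *)
apply: (@squeeze_cvgr _ _ _ _ (cst 0)
  (fun n => survival q m n * (mean_delay q true + mean_delay q false))).
- have md0 b : 0 <= mean_delay q b.
    apply: divr_ge0; first by case: b; lra.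
    by apply/ltW/mean_delay_den_gt0; lra.
  apply: nearW => n; have s0 : 0 <= survival q m n by apply: survival_ge0; lra.
  rewrite mulr_ge0//= ler_wpM2l//.
  by case: (m (+) odd n); rewrite ?lerDl ?lerDr.
- exact: cvg_cst.
- rewrite -(mul0r (mean_delay q true + mean_delay q false)).
  by apply: cvgMr_tmp; apply: survival_cvg0.
Qed.

(** * Law of the undecided phase given the AI signal and the state *)

Lemma prob_undecided (R : realType) (pi0 q alpha : R)
    (M : cascade_model pi0 q alpha) (k : nat) (x t : bool) :
  Pr M (undecided M k `&` [set w | ai M w = x /\ theta M w = t]) =
  ((survival q (x == t) k)%:E *
   Pr M [set w | ai M w = x /\ theta M w = t])%E.
Proof.
pose E j := undecided M j `&` [set w | ai M w = x].
have EA j : undecided M j `&` [set w | ai M w = x /\ theta M w = t] =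
            E j `&` [set w | theta M w = t].
  by rewrite /E -setIA.
rewrite EA; elim: k => [|k IHk].
  rewrite /survival big_ord0 mul1e -EA; congr (Pr M _).
  by apply/seteqP; split => // w [].
rewrite survivalS EFinM [X in (X * _)%E]muleC -muleA -IHk.
(* Once the AI signal is fixed to [x], not breaking at [k] prescribes the value of signal [k]. *)
have -> : E k.+1 = E k `&` [set w | sig M k w = x (+) ~~ odd k].
  apply/seteqP; split => w; rewrite /E /=.
    move=> [/undecidedS[wk bk] wx]; split=> //; move: bk; rewrite /breaking wx.
    by case: (sig M k w) x (odd k) {EA IHk E wx} => [] [] [].
  move=> [[wk wx] wk']; split=> //; apply/undecidedS; split=> //.
  by rewrite /breaking wx wk'; case: x {EA IHk E wx wk'}; case: (odd k).
rewrite prob_next_signal; last first.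
  move=> v w vw [vk vx]; split; first exact: (undecided_determined vw).
  by rewrite /= -(agree_upto_ai vw).
congr (_%:E * _)%E; rewrite /agreement.
by case: x {EA IHk E}; case: t; case: (odd k).
Qed.

Lemma measurable_ai_eq_theta (R : realType) (pi0 q alpha : R)
    (M : cascade_model pi0 q alpha) (m : bool) :
  measurable [set w | (ai M w == theta M w) = m].
Proof.
have -> : [set w | (ai M w == theta M w) = m] =
  [set w | ai M w = m /\ theta M w = true] `|`
  [set w | ai M w = ~~ m /\ theta M w = false].
  apply/seteqP; split => w /=; case: (ai M w); case: (theta M w); case: m => //;
    by [left|right|case=> -[]].
by apply: measurableU; apply: measurableI; apply: measurable_rv_eq.
Qed.

(** The event splits according to the state, and both pieces carry the same survival factor because
    it depends only on [m]. *)
Lemma prob_undecided_ai_eq_theta (R : realType) (pi0 q alpha : R)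
    (M : cascade_model pi0 q alpha) (k : nat) (m : bool) :
  Pr M (undecided M k `&` [set w | (ai M w == theta M w) = m]) =
  ((survival q m k)%:E * Pr M [set w | (ai M w == theta M w) = m])%E.
Proof.
pose A t := [set w | ai M w = (t (+) ~~ m) /\ theta M w = t].
have mA t : measurable (A t).
  by apply: measurableI; apply: measurable_rv_eq.
have AE : [set w | (ai M w == theta M w) = m] = A true `|` A false.
  apply/seteqP; split => w; rewrite /A /=; case: (ai M w); case: (theta M w);
    case: m {A mA} => //; by [left|right|case=> -[]].
have PA t : Pr M (undecided M k `&` A t) = ((survival q m k)%:E * Pr M (A t))%E.
  rewrite prob_undecided (_ : (t (+) ~~ m) == t = m)//.
  by case: t; case: m {A mA AE}.
have dis (U : set (Omega M)) : (U `&` A true) `&` (U `&` A false) = set0.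
  by apply/seteqP; split => // w [[_ [_ tw]] [_ [_]]]; rewrite tw.
have mU := measurable_undecided M k.
rewrite AE setIUr measureU//; do ?exact: measurableI.
rewrite measureU//; last by have := dis setT; rewrite !setTI.
rewrite [RHS]ge0_muleDr//; congr (_ + _)%E; exact: PA.
Qed.

Lemma prob_ai_eq_theta_gt0 (R : realType) (pi0 q alpha : R)
    (M : cascade_model pi0 q alpha) (m : bool) :
  0 < alpha < 1 -> (0 < Pr M [set w | (ai M w == theta M w) = m])%E.
Proof.
move=> a01; apply: (@lt_le_trans _ _ (Pr M [set w | ai M w = m /\ theta M w = true])).
  rewrite prob_ai_theta lte_fin mulr_gt0//.
    by case/andP: (agreement_itv m true a01).
  by have /andP[] := prior_nondegenerate M.
apply: le_measure; rewrite ?inE.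
- by apply: measurableI; apply: measurable_rv_eq.
- exact: measurable_ai_eq_theta.
- by move=> w /= [-> ->]; case: m.
Qed.

(** * Conditional mean and law of the cascade time *)

Lemma probabilityD (d : measure_display) (T : measurableType d) (R : realType)
    (P : probability T R) (A B : set T) :
  measurable A -> measurable B -> B `<=` A -> P (A `\` B) = (P A - P B)%E.
Proof.
move=> mA mB BA; rewrite measureD ?setIidr//.
by rewrite ltey_eq fin_num_measure.
Qed.

(** Integrate the tail-sum form over [D] term by term, all terms being nonnegative; the survival
    factorization on [D] turns the sum into [survival_series]. *)
Lemma cexpectation_cascade_time (R : realType) (pi0 q alpha : R)
    (M : cascade_model pi0 q alpha) (m : bool) (D : set (Omega M)) :
  logit pi0 = 0 -> 2^-1 < alpha < q -> q < 1 ->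
  measurable D -> (0 < Pr M D)%E ->
  (forall k, Pr M (undecided M k `&` D) = ((survival q m k)%:E * Pr M D)%E) ->
  cexpectation (Pr M) (cascade_time M) D = (1 + mean_delay q m)%:E.
Proof.
move=> pi00 aq q1 mD D0 survD.
have q_itv : 2^-1 < q < 1 by lra.
have finD : Pr M D \is a fin_num by exact: fin_num_measure.
rewrite /cexpectation.
have mI k : measurable_fun D (EFin \o \1_(undecided M k) : Omega M -> \bar R).
  by apply/measurable_EFinP/measurable_indic/measurable_undecided.
have -> : (\int[Pr M]_(w in D) cascade_time M w =
           (1 + mean_delay q m)%:E * Pr M D)%E.
  under eq_integral do rewrite cascade_time_series//.
  rewrite ge0_integralD//; last 2 first.
  - by move=> w _; apply: nneseries_ge0 => k _ _; rewrite lee_fin.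
  - apply: (ge0_emeasurable_sum (P := xpredT)
      (h := fun k w => (\1_(undecided M k) w)%:E)).
      by move=> k w _ _; rewrite lee_fin.
    by move=> k _; apply: mI.
  rewrite integral_cst// mul1e integral_nneseries//.
  rewrite (eq_eseriesr
    (g := fun k => (fine (Pr M D))%:E * (survival q m k)%:E)%E); last first.
    move=> k _; rewrite integral_indic//; last exact: measurable_undecided.
    by apply: etrans (survD k) _; rewrite fineK// muleC.
  rewrite nneseriesZl; last by move=> k _; rewrite lee_fin survival_ge0//; lra.
  rewrite survival_series// -[X in (X + _)%E]fineK// -[X in _ = (_ * X)%E]fineK//.
  by rewrite -!EFinM -EFinD; congr EFin; ring.
rewrite -{1}(fineK finD) -!EFinM mulfK//.
by rewrite fine_eq0// gt_eqF.
Qed.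

(** The time is 2 exactly when the very first signal breaks, which is the complement of
    [undecided M 1]. *)
Lemma cprob_cascade_time2 (R : realType) (pi0 q alpha : R)
    (M : cascade_model pi0 q alpha) (m : bool) (D : set (Omega M)) :
  logit pi0 = 0 -> 2^-1 < alpha < q -> q < 1 ->
  measurable D -> (0 < Pr M D)%E ->
  (forall k, Pr M (undecided M k `&` D) = ((survival q m k)%:E * Pr M D)%E) ->
  cprob (Pr M) [set w | cascade_time M w = 2%:E] D = agreement q m true.
Proof.
move=> pi00 aq q1 mD D0 survD.
have finD : Pr M D \is a fin_num by exact: fin_num_measure.
have mU := measurable_undecided M 1.
rewrite /cprob.
have -> : [set w | cascade_time M w = 2%:E] `&` D = D `\` (undecided M 1 `&` D).
  apply/seteqP; split => w [].
    move=> /= w2 Dw; split=> // -[w1 _].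
    have [wk|[k [wk bk]]] := undecided_or_breaking w.
      by rewrite cascade_time_undecided in w2.
    move: w2; rewrite (cascade_time_breaking _ _ _ wk bk)// => -[] /eqP.
    rewrite eqr_nat => /eqP[k0]; rewrite k0 in bk.
    by have /negP := w1 0%N isT.
  move=> Dw nU; split=> //=; apply: (cascade_time_breaking (k := 0)) => //.
  by apply: contra_notT nU => b0; split=> // -[].
rewrite probabilityD//; last exact: measurableI.
rewrite survD -{1 2}(fineK finD) -EFinM -EFinB /= -{1}[fine (Pr M D)]mul1r -mulrBl.
rewrite mulfK; last by rewrite fine_eq0// gt_eqF.
rewrite survivalS /survival big_ord0 mul1r /agreement; case: m {survD} => /=; ring.
Qed.

(** The term at [k] is the mass at the time [k + 2]; the value [+oo] gets none. The formula does not
    mention [alpha]. *)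
Definition cascade_law (R : realType) (q : R) (m : bool) (B : set (\bar R)) : R :=
  fine (\sum_(k <oo | k \in [set k | B (k.+2%:R)%:E])
          (survival q m k - survival q m k.+1)%:E)%E.

(** Cut [D] along the first breaking index: the pieces [F k] are disjoint, the time is constant on
    each, and what remains is null. *)
Lemma cprob_cascade_time (R : realType) (pi0 q alpha : R)
    (M : cascade_model pi0 q alpha) (m : bool) (D : set (Omega M))
    (B : set (\bar R)) :
  logit pi0 = 0 -> 2^-1 < alpha < q -> q < 1 ->
  measurable D -> (0 < Pr M D)%E ->
  (forall k, Pr M (undecided M k `&` D) = ((survival q m k)%:E * Pr M D)%E) ->
  cprob (Pr M) (cascade_time M @^-1` B) D = cascade_law q m B.
Proof.
move=> pi00 aq q1 mD D0 survD.
have q_itv : 2^-1 < q < 1 by lra.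
have finP (A : set (Omega M)) : measurable A -> Pr M A \is a fin_num.
  exact: fin_num_measure.
have PD0 : fine (Pr M D) != 0 by rewrite fine_eq0 ?finP// gt_eqF.
have mU k : measurable (undecided M k `&` D).
  by apply: measurableI => //; apply: measurable_undecided.
pose F k := (undecided M k `&` D) `\` (undecided M k.+1 `&` D).
pose K := [set k | B (k.+2%:R)%:E].
(* The first factor is the whole space or empty, according to whether [B] contains [+oo]. *)
pose N := [set w | B +oo%E] `&` ((\bigcap_k undecided M k) `&` D).
have mF k : measurable (F k) by apply: measurableD.
have FE k : F k = [set w | undecided M k w /\ breaking k w] `&` D.
  apply/seteqP; split => w.
    move=> [[wk Dw] nU]; split=> //; split=> //; apply: contra_notT nU => bk.
    by split=> //; apply/undecidedS.
  by move=> [[wk bk] Dw]; split=> // -[/undecidedS[_]]; rewrite bk.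
have mcap : measurable ((\bigcap_k undecided M k) `&` D).
  apply: measurableI => //; apply: bigcap_measurable; first by exists 0%N.
  by move=> k _; apply: measurable_undecided.
have mN : measurable N.
  have [Boo|Boo] := pselect (B +oo%E).
    rewrite (_ : N = (\bigcap_k undecided M k) `&` D)//.
    by apply/seteqP; split => // w [].
  rewrite (_ : N = set0)//; by apply/seteqP; split => // w [].
(* For every [k] this probability is at most [survival q m k] times that of [D], which tends to
   0. *)
have cap0 : Pr M ((\bigcap_k undecided M k) `&` D) = 0%E.
  apply/eqP; rewrite eq_le measure_ge0 andbT.
  have lim0 : ((survival q m k)%:E * Pr M D)%E @[k --> \oo] --> 0%E.
    rewrite -(mul0e (Pr M D)); apply: cvgeZr; first exact: finP.
    by apply: cvg_EFin; [exact: nearW | exact: survival_cvg0].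
  apply: (cvge_to_ge lim0); apply: nearW => k; rewrite -survD.
  apply: le_measure; rewrite ?inE// => w [wcap Dw]; split=> //; exact: wcap.
have preE : cascade_time M @^-1` B `&` D = (\bigcup_(k in K) F k) `|` N.
  apply/seteqP; split => w.
    move=> [/= Bw Dw]; have [wk|[k [wk bk]]] := undecided_or_breaking w.
      by rewrite cascade_time_undecided// in Bw; right; split=> //; split=> // k _.
    left; exists k; last by rewrite FE.
    by rewrite (cascade_time_breaking _ _ _ wk bk) in Bw.
  move=> [[k Kk]|[Boo [wk Dw]]].
    by rewrite FE => -[[wk bk] Dw]; split=> //=; rewrite (cascade_time_breaking _ _ _ wk bk).
  by split=> //=; rewrite cascade_time_undecided// => k; apply: wk.
have trivF : trivIset K F.
  move=> i j _ _ [w []]; rewrite !FE => -[[wi bi] _] [[wj bj] _].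
  have [ij|ji|//] := ltngtP i j.
    by have /negP := wj _ ij.
  by have /negP := wi _ ji.
have PF k : Pr M (F k) =
    ((fine (Pr M D))%:E * (survival q m k - survival q m k.+1)%:E)%E.
  rewrite probabilityD//; last by apply: setSI; apply: undecided_le.
  by rewrite !survD -{1 2}(fineK (finP _ mD)) -!EFinM -EFinB -mulrBl mulrC.
have dec k : (0 <= (survival q m k - survival q m k.+1)%:E)%E.
  rewrite lee_fin survivalS -{1}[survival q m k]mulr1 -mulrBr mulr_ge0 ?survival_ge0//; first lra.
  by rewrite /agreement; case: (_ == _); lra.
have mK : measurable (\bigcup_(k in K) F k).
  by apply: bigcup_measurable => k _.
have N0 : Pr M N = 0%E.
  by apply: subset_measure0 cap0 => // w [].
have PN : Pr M ((\bigcup_(k in K) F k) `|` N) = Pr M (\bigcup_(k in K) F k).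
  exact: measureU0.
have PK : Pr M (\bigcup_(k in K) F k) = ((fine (Pr M D))%:E *
    \sum_(k <oo | k \in K) (survival q m k - survival q m k.+1)%:E)%E.
  rewrite -nneseriesZl//; rewrite [LHS]measure_bigcup//.
  by apply: eq_eseriesr => k _; apply: PF.
(* Finiteness of the probability excludes an infinite series, since its factor, the probability of
   [D], is positive. *)
have := finP _ mK; rewrite /cprob preE PN PK /cascade_law -/K.
have x0 : (0 < (fine (Pr M D))%:E)%E by rewrite fineK ?finP.
case: (\sum_(_ <oo | _) _)%E => [s| |].
- by rewrite -EFinM /= mulrAC divff// mul1r.
- by rewrite gt0_muley.
- by rewrite gt0_muleNy.
Qed.

(** * The accurate-AI regime and the final assembly *)

(** With a symmetric prior the initial public log-odds are [logit alpha] in absolute value, already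
    at the threshold. *)
Lemma cascade_time_accurate_ai (R : realType) (pi0 q alpha : R)
    (M : cascade_model pi0 q alpha) (w : Omega M) :
  logit pi0 = 0 -> 0 < q -> 2^-1 < alpha < 1 -> q <= alpha ->
  cascade_time M w = 1%:E.
Proof.
move=> pi00 q0 a_itv qa; apply/eqP; rewrite eq_le; apply/andP; split.
  apply: ereal_inf_lbound; exists 0%N => //=.
  rewrite pi00 add0r llrE (_ : `|_| = logit alpha); last first.
    by case: (ai M w); rewrite ?normrN gtr0_norm ?logit_gt0.
  by apply: logit_ler; lra.
by apply: le_ereal_inf_tmp => _ [j _ <-]; rewrite lee_fin ler1n.
Qed.

Theorem proposition6 (R : realType) (q : R) (q_gt : 2^-1 < q) (q_lt : q < 1) :
  (forall (pi0 alpha : R) (M : cascade_model pi0 q alpha),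
      logit pi0 = 0 -> 2^-1 < alpha < 1 -> q <= alpha ->
      forall w : Omega M, cascade_time M w = 1%:E)
  /\
  (exists nu : bool -> set (\bar R) -> R,
    forall (pi0 alpha : R) (M : cascade_model pi0 q alpha),
      logit pi0 = 0 -> 2^-1 < alpha < q ->
      forall (x t : bool) (B : set (\bar R)), measurable B ->
        cprob (Pr M) (cascade_time M @^-1` B)
          [set w | ai M w = x /\ theta M w = t] = nu (x == t) B)
  /\
  (forall (pi0 alpha : R) (M : cascade_model pi0 q alpha),
      logit pi0 = 0 -> 2^-1 < alpha < q ->
      let tau := cascade_time M in
      let correct := [set w | ai M w = theta M w] in
      let wrong := [set w | ai M w <> theta M w] in
      cprob (Pr M) [set w | tau w = 2%:E] correct = q /\
      cprob (Pr M) [set w | tau w = 2%:E] wrong = 1 - q /\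
      cexpectation (Pr M) tau correct = (1 + (2 - q) / (1 - q + q ^+ 2))%:E /\
      cexpectation (Pr M) tau wrong = (1 + (1 + q) / (1 - q + q ^+ 2))%:E /\
      (cexpectation (Pr M) tau correct < cexpectation (Pr M) tau wrong)%E /\
      (cexpectation (Pr M) tau wrong - cexpectation (Pr M) tau correct)%E
        = ((2 * q - 1) / (1 - q + q ^+ 2))%:E /\
      0 < (2 * q - 1) / (1 - q + q ^+ 2)).
Proof.
have q0 : 0 < q by lra.
split=> [pi0 alpha M pi00 a_itv qa w|]; first exact: cascade_time_accurate_ai.
split.
  (* The witness is chosen before [pi0], [alpha] and the model, which expresses that the law is the
     same for all [alpha]. *)
  exists (cascade_law q) => pi0 alpha M pi00 aq x t B _.
  have a01 : 0 < alpha < 1 by lra.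
  apply: cprob_cascade_time => //.
  - by apply: measurableI; apply: measurable_rv_eq.
  - rewrite prob_ai_theta lte_fin mulr_gt0//.
      by case/andP: (agreement_itv x t a01).
    by have := prob_theta_gt0 M t; rewrite prob_theta lte_fin.
  - by move=> k; apply: prob_undecided.
move=> pi0 alpha M pi00 aq tau correct wrong.
have a01 : 0 < alpha < 1 by lra.
have correctE : correct = [set w | (ai M w == theta M w) = true].
  by apply/seteqP; split => w /eqP.
have wrongE : wrong = [set w | (ai M w == theta M w) = false].
  by apply/seteqP; split => w /=; case: eqP.
have time2 m : cprob (Pr M) [set w | tau w = 2%:E]
    [set w | (ai M w == theta M w) = m] = agreement q m true.
  apply: cprob_cascade_time2 => //; first exact: measurable_ai_eq_theta.
    exact: prob_ai_eq_theta_gt0.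
  by move=> k; apply: prob_undecided_ai_eq_theta.
have mean m : cexpectation (Pr M) tau [set w | (ai M w == theta M w) = m] =
    (1 + mean_delay q m)%:E.
  apply: cexpectation_cascade_time => //; first exact: measurable_ai_eq_theta.
    exact: prob_ai_eq_theta_gt0.
  by move=> k; apply: prob_undecided_ai_eq_theta.
have den0 := mean_delay_den_gt0 q_lt.
have diffE : mean_delay q false - mean_delay q true =
    (2 * q - 1) / (1 - q + q ^+ 2).
  by rewrite /mean_delay -mulrBl; congr (_ / _); ring.
have diff0 : 0 < (2 * q - 1) / (1 - q + q ^+ 2) by apply: divr_gt0 => //; lra.
rewrite correctE wrongE !time2 !mean; do 4!split=> //.
split; first by rewrite lte_fin ltrD2l -subr_gt0 diffE.
by split=> //; rewrite -EFinB opprD addrACA subrr add0r diffE.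
Qed.
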